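(* Let $A,B\in\mathbb{M}_n^+$ and $p\ge1$. Then, for all contractions $Z\in\mathbb{M}_n$, $$(AZ^*BZA)^p\prec_{w\log}A^pZ^*B^pZA^p.$$
   Context: $\mathbb{M}_n$ is the space of $n\times n$ complex matrices and $\mathbb{M}_n^+$ its positive semidefinite part. $Z$ is a contraction if $Z^*Z\le I$ (Loewner order). For $S,T\in\mathbb{M}_n^+$, $S\prec_{w\log}T$ means $\prod_{j=1}^k\lambda_j(S)\le\prod_{j=1}^k\lambda_j(T)$ for every $k=1,\ldots,n$, where $\lambda_1(\cdot)\ge\cdots\ge\lambda_n(\cdot)$ are the eigenvalues arranged in decreasing order (with multiplicity). *)

(* Defs.v *)
From HB Require Import structures.
From mathcomp Require Import all_boot all_order all_algebra.
From mathcomp Require Import complex.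
From mathcomp Require Import reals exp.
Set Implicit Arguments.
Unset Strict Implicit.
Unset Printing Implicit Defensive.
Import Order.TTheory GRing.Theory Num.Theory.
Local Open Scope ring_scope.
Local Open Scope complex_scope.
Local Open Scope sesquilinear_scope.

Section Defs.
Context {R : realType} {n : nat}.
Local Notation C := R[i].
Implicit Types S T A Z : 'M[C]_n.

(* The order of R[i] is partial: [0 <= z] says that z is real and nonnegative. *)
Definition psdmx A : Prop :=
  A = A^t* /\ forall x : 'cV[C]_n, 0 <= (x^t* *m A *m x) 0 0.

Definition loewner_le S T : Prop := psdmx (T - S).

Definition contraction Z : Prop := loewner_le (Z^t* *m Z) 1%:M.

(* Real power of a positive semidefinite matrix by functional calculus: if
   A = U^* diag(d) U with U unitary, then A^p = U^* diag(d^p) U.  The entries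
   of d are then real, so taking real parts loses nothing; 0 `^ p = 0 for
   p != 0.  The value is meaningless when A is not positive semidefinite. *)
Definition mxpowR A (p : R) : 'M[C]_n :=
  (spectralmx A)^t*
  *m diag_mx (map_mx (fun z : C => (powR (complex.Re z) p)%:C) (spectral_diag A))
  *m spectralmx A.

(* The roots of the characteristic polynomial, with multiplicity. *)
Definition eigenvalues S : seq C :=
  sval (closed_field_poly_normal (char_poly S)).

(* [lambda S j] is the eigenvalue number j.+1 of S in decreasing order, for S
   with real spectrum (e.g. positive semidefinite): indices start at 0. *)
Definition lambda S (j : nat) : R :=
  nth 0 (sort >=%R [seq complex.Re z | z <- eigenvalues S]) j.

Definition weak_log_maj S T : Prop :=
  forall k : nat, (1 <= k <= n)%N ->
    \prod_(j < k) lambda S j <= \prod_(j < k) lambda T j.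

End Defs.

(* Main.v *)
Require Import Defs.
From HB Require Import structures.
From mathcomp Require Import all_boot all_order all_algebra.
From mathcomp Require Import fingroup perm.
From mathcomp Require Import complex.
From mathcomp Require Import reals exp.
From mathcomp Require Import ring lra.
Set Implicit Arguments.
Unset Strict Implicit.
Unset Printing Implicit Defensive.
Import Order.TTheory GRing.Theory Num.Theory.
Local Open Scope ring_scope.
Local Open Scope complex_scope.
Local Open Scope sesquilinear_scope.

(* Put P_s = A^s Z^* B^s Z A^s and let h(s) be the product of its k largest
   eigenvalues.  For positive semidefinite S this product is the least c with
   det(V S V^* ) <= c det(V V^* ) for all k x n matrices V, attained at
   eigenvectors of S; the upper bound and the Cauchy-Schwarz inequality
   |det(X Y^* )|^2 <= det(X X^* ) det(Y Y^* ) both follow from Cauchy-Binet.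
   Write P_s = N_s N_s^* with N_s = A^s Z^* B^(s/2).  If m = (s + t)/2 and
   V P_m = L V, then V' = V A^(m-s) satisfies V' N_s N_t^* = L V', and
   Cauchy-Schwarz applied to V' N_s and V' N_t gives h(m)^2 <= h(s) h(t).
   As h(0) <= 1 because Z is a contraction, and h is bounded on [0, p],
   midpoint log-convexity yields h(1)^p <= h(p), which is the claim. *)

(** * The Cauchy-Binet formula *)

Section CauchyBinet.
Context {R : comNzRingType} {k n : nat}.
Implicit Types (A : 'M[R]_(k, n)) (B : 'M[R]_(n, k)).

(** Multilinearity in the rows of [A *m B]: distributing the product over the entries turns each
    choice of summands into a map [f]. *)
Lemma det_mulmx_expand A B :
  \det (A *m B) =
    \sum_(f : {ffun 'I_k -> 'I_n}) (\prod_i A i (f i)) * \det (rowsub f B).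
Proof.
rewrite /determinant.
under eq_bigr => s _.
  under eq_bigr => i _ do rewrite mxE.
  rewrite bigA_distr_bigA mulr_sumr.
  over.
rewrite exchange_big; apply: eq_bigr => f _.
rewrite mulr_sumr; apply: eq_bigr => s _.
rewrite big_split /= mulrCA; congr (_ * (_ * _)).
by apply: eq_bigr => i _; rewrite !mxE.
Qed.

(* Summing over all maps instead of increasing ones avoids choosing an
   enumeration of the k-subsets; each subset is then counted k! times. *)
Lemma cauchy_binet A B :
  \det (A *m B) *+ k`! =
    \sum_(f : {ffun 'I_k -> 'I_n}) \det (colsub f A) * \det (rowsub f B).
Proof.
(* One identity for each [s]: composing [f] with [s] permutes the rows of [rowsub f B] at the cost
   of a sign. Adding these over all [s] collects the first factors into [\det (colsub f A)]. *)
have perm_term (s : 'S_k) : \det (A *m B) =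
  \sum_(f : {ffun 'I_k -> 'I_n})
    ((-1) ^+ s * \prod_i A i (f (s i))) * \det (rowsub f B).
  rewrite det_mulmx_expand.
  rewrite (reindex (fun f : {ffun 'I_k -> 'I_n} => [ffun i => f (s i)])) /=.
    apply: eq_bigr => f _.
    under eq_bigr => i _ do rewrite ffunE.
    rewrite -mulrA mulrCA; congr (_ * _).
    rewrite -det_perm -det_mulmx; congr (\det _).
    by rewrite -row_permE; apply/matrixP => i j; rewrite !mxE ffunE.
  exists (fun f : {ffun 'I_k -> 'I_n} => [ffun i => f (s^-1%g i)]) => f _.
    by apply/ffunP => i; rewrite !ffunE permKV.
  by apply/ffunP => i; rewrite !ffunE permK.
rewrite -card_Sn -sumr_const.
under eq_bigr => s _ do rewrite (perm_term s).
rewrite exchange_big; apply: eq_bigr => f _.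
rewrite -mulr_suml; congr (_ * _); rewrite [RHS]/determinant.
rewrite (eq_bigl xpredT) //; apply: eq_bigr => s _; congr (_ * _).
by apply: eq_bigr => i _; rewrite !mxE.
Qed.

End CauchyBinet.

(** * Gram determinants and their Cauchy-Schwarz inequality *)

Section Gram.
Context {C : numClosedFieldType}.
(* On top of complex_scope, so that [z^*] is the abstract conjugation. *)
Local Open Scope ring_scope.

Lemma trmxC_mul m n q (A : 'M[C]_(m, n)) (B : 'M[C]_(n, q)) :
  (A *m B)^t* = B^t* *m A^t*.
Proof. by rewrite trmx_mul map_mxM. Qed.

Lemma det_trmxC n (A : 'M[C]_n) : \det (A^t*) = (\det A)^*.
Proof. by rewrite det_map_mx det_tr. Qed.

(** Lagrange's identity: the difference of the two sides is half the sum [S] of squares. *)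
Lemma CauchySchwarz_sum (I : finType) (x y : I -> C) :
  `|\sum_i x i * (y i)^*| ^+ 2 <= (\sum_i `|x i| ^+ 2) * (\sum_i `|y i| ^+ 2).
Proof.
pose S := \sum_i \sum_j `|x i * y j - x j * y i| ^+ 2.
have S0 : 0 <= S by do 2!(apply: sumr_ge0 => ? _); rewrite exprn_ge0.
suff -> : (\sum_i `|x i| ^+ 2) * (\sum_i `|y i| ^+ 2) =
    `|\sum_i x i * (y i)^*| ^+ 2 + S / 2.
  by rewrite lerDl divr_ge0.
have E1 (u v : I -> C) : \sum_i \sum_j u i * v j = (\sum_i u i) * (\sum_i v i).
  by rewrite mulr_suml; apply: eq_bigr => i _; rewrite mulr_sumr.
have E2 (u v : I -> C) : \sum_i \sum_j u j * v i = (\sum_i u i) * (\sum_i v i).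
  by rewrite exchange_big E1.
pose z i := x i * (y i)^*.
have -> : S = \sum_i \sum_j (`|x i| ^+ 2 * `|y j| ^+ 2)
    + \sum_i \sum_j (`|x j| ^+ 2 * `|y i| ^+ 2)
    - (\sum_i \sum_j (z i * (z j)^* ) + \sum_i \sum_j (z j * (z i)^* )).
  rewrite -!big_split -sumrB; apply: eq_bigr => i _.
  rewrite -!big_split -sumrB; apply: eq_bigr => j _.
  by rewrite /z !normCK !rmorphB !rmorphM /= !conjCK; ring.
have E1z : _ = _ * \sum_i (z i)^* := E1 z _.
have E2z : _ = _ * \sum_i (z i)^* := E2 z _.
rewrite E1z E2z E1 E2 normCK (rmorph_sum _ _ _ z).
by field.
Qed.

Lemma det_gramE k n (X : 'M[C]_(k, n)) :
  \det (X *m X^t* ) *+ k`! =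
    \sum_(f : {ffun 'I_k -> 'I_n}) `|\det (colsub f X)| ^+ 2.
Proof.
rewrite cauchy_binet; apply: eq_bigr => f _; rewrite normCK -det_trmxC.
by congr (_ * \det _); apply/matrixP => i j; rewrite !mxE.
Qed.

Lemma det_gram_ge0 k n (X : 'M[C]_(k, n)) : 0 <= \det (X *m X^t* ).
Proof.
by rewrite -(pmulrn_lge0 _ (fact_gt0 k)) det_gramE sumr_ge0 // => f _; rewrite exprn_ge0.
Qed.

(** By Cauchy-Binet the three determinants are, up to the factor k factorial, the inner product and
    the squared norms of the two vectors of maximal minors. *)
Lemma det_gram_CauchySchwarz k n (X Y : 'M[C]_(k, n)) :
  `|\det (X *m Y^t* )| ^+ 2 <= \det (X *m X^t* ) * \det (Y *m Y^t* ).
Proof.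
have k0 : 0 < (k`!%:R : C) ^+ 2 by rewrite exprn_gt0 // ltr0n fact_gt0.
rewrite -(ler_pM2r k0) [in leRHS]expr2 [leRHS]mulrACA !mulr_natr !det_gramE.
rewrite -[in leLHS](normr_nat C k`!) -exprMn -normrM mulr_natr cauchy_binet.
apply: le_trans (CauchySchwarz_sum _ _); rewrite le_eqVlt; apply/orP; left.
apply/eqP; congr (`|_| ^+ 2); apply: eq_bigr => f _; rewrite -det_trmxC.
by congr (_ * \det _); apply/matrixP => i j; rewrite !mxE.
Qed.

End Gram.

(** * Unitary diagonalisation and determinants of compressions *)

Section SpectralForm.
Context {C : numClosedFieldType} {n : nat}.
Local Open Scope ring_scope.
Implicit Types (S U : 'M[C]_n) (d e : 'rV[C]_n).

(** The adjoint stands on the left, as in [mxpowR], so for unitary [U] the rows of [U] are left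
    eigenvectors. *)
Definition spectral_form U d : 'M[C]_n := U^t* *m diag_mx d *m U.

Lemma spectral_formE U d i j :
  spectral_form U d i j = \sum_l (U l i)^* * d 0 l * U l j.
Proof.
by rewrite /spectral_form mul_mx_diag mxE; apply: eq_bigr => l _; rewrite !mxE.
Qed.

Lemma spectral_form_perm U d (s : 'S_n) :
  spectral_form (row_perm s U) (col_perm s d) = spectral_form U d.
Proof.
apply/matrixP => i j; rewrite !spectral_formE [RHS](reindex_perm s).
by apply: eq_bigr => l _; rewrite !mxE.
Qed.

Lemma unitarymx_row_perm U (s : 'S_n) :
  U \is unitarymx -> row_perm s U \is unitarymx.
Proof.
move=> /unitarymxP UU1; apply/unitarymxP/matrixP => i j.
move/matrixP/(_ (s i) (s j)): UU1; rewrite !mxE (inj_eq perm_inj) => <-.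
by apply: eq_bigr => l _; rewrite !mxE.
Qed.

Lemma unitarymx_adjl U : U \is unitarymx -> U^t* *m U = 1%:M.
Proof. by move=> U_unitary; rewrite -[_ *m _]mul1mx mulmxA mulmxKtV. Qed.

Lemma spectral_form_mul U d e : U \is unitarymx ->
  spectral_form U d *m spectral_form U e =
    spectral_form U (\row_j (d 0 j * e 0 j)).
Proof.
by move=> U_unitary; rewrite /spectral_form -mulmx_diag !mulmxA mulmxtVK.
Qed.

Lemma spectral_form_adj U d : (forall j, d 0 j \is Num.real) ->
  (spectral_form U d)^t* = spectral_form U d.
Proof.
move=> d_real; apply/matrixP => i j; rewrite mxE mxE !spectral_formE rmorph_sum.
apply: eq_bigr => l _; rewrite !rmorphM /= conjCK conj_Creal //; ring.
Qed.

Lemma spectral_form1 U : U \is unitarymx ->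
  spectral_form U (const_mx 1) = 1%:M.
Proof.
move=> U_unitary.
by rewrite /spectral_form diag_const_mx mulmx1 unitarymx_adjl.
Qed.

Lemma char_poly_spectral_form U d : U \is unitarymx ->
  char_poly (spectral_form U d) = \prod_i ('X - (d 0 i)%:P).
Proof.
move=> U_unitary; pose D := diag_mx d.
have UU1 := unitarymx_adjl U_unitary.
have -> : char_poly (spectral_form U d) = char_poly D.
  rewrite /char_poly /char_poly_mx.
  have -> : 'X%:M - map_mx polyC (spectral_form U d) =
      map_mx polyC (U^t* ) *m ('X%:M - map_mx polyC D) *m map_mx polyC U.
    rewrite mulmxBr mulmxBl -!map_mxM; congr (_ - _).
    by rewrite scalar_mxC -mulmxA -map_mxM UU1 map_mx1 mulmx1.
  by rewrite !det_mulmx mulrAC -det_mulmx -map_mxM UU1 map_mx1 det1 mul1r.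
rewrite char_poly_trig ?diag_mx_is_trig //.
by apply: eq_bigr => i _; rewrite !mxE eqxx.
Qed.

(** In eigenvector coordinates [X], Cauchy-Binet makes the left side a sum of squared minors of [X]
    weighted by products of entries of [d]. A repeated index gives equal columns and a zero minor,
    so only injective [f] count. *)
Lemma det_compression_le k U d (c : C) (V : 'M[C]_(k, n)) :
    U \is unitarymx ->
    (forall f : 'I_k -> 'I_n, injective f -> \prod_i d 0 (f i) <= c) ->
  \det (V *m spectral_form U d *m V^t* ) <= c * \det (V *m V^t* ).
Proof.
move=> U_unitary d_le; pose X := V *m U^t*.
have -> : V *m V^t* = X *m X^t*.
  by rewrite /X trmxC_mul trmxCK !mulmxA -[V *m _ *m U]mulmxA unitarymx_adjl ?mulmx1.
have -> : V *m spectral_form U d *m V^t* = (X *m diag_mx d) *m X^t*.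
  by rewrite /X trmxC_mul trmxCK /spectral_form !mulmxA.
have k0 : 0 < k`!%:R :> C by rewrite ltr0n fact_gt0.
rewrite -(ler_pM2r k0) -mulrA !mulr_natr det_gramE cauchy_binet mulr_sumr.
apply: ler_sum => f _.
have -> : \det (rowsub f (X^t* )) = (\det (colsub f X))^*.
  by rewrite -det_trmxC; congr (\det _); apply/matrixP => i j; rewrite !mxE.
have -> : colsub f (X *m diag_mx d) = colsub f X *m diag_mx (\row_i d 0 (f i)).
  by apply/matrixP => i j; rewrite mul_mx_diag mxE mul_mx_diag !mxE.
rewrite det_mulmx det_diag mulrAC -normCK.
have [f_inj|] := boolP (injectiveb f).
  rewrite mulrC ler_wpM2r ?exprn_ge0 //.
  under eq_bigr => i _ do rewrite mxE.
  exact/d_le/injectiveP.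
case/injectivePn => i [j ne_ij eq_f].
suff -> : \det (colsub f X) = 0 by rewrite normr0 expr0n mul0r mulr0.
by rewrite -det_tr; apply: (determinant_alternate ne_ij) => l; rewrite !mxE eq_f.
Qed.

Lemma spectral_form_frame k (le_kn : (k <= n)%N) U d : U \is unitarymx ->
  exists2 V : 'M[C]_(k, n), V *m V^t* = 1%:M &
    V *m spectral_form U d =
      diag_mx (\row_i d 0 (widen_ord le_kn i)) *m V.
Proof.
move=> U_unitary; exists (rowsub (widen_ord le_kn) U).
  apply/matrixP => i j; move/unitarymxP/matrixP: U_unitary.
  move/(_ (widen_ord le_kn i) (widen_ord le_kn j)).
  rewrite !mxE -[widen_ord _ _ == _]val_eqE -[i == j]val_eqE => <-.
  by apply: eq_bigr => l _; rewrite !mxE.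
rewrite mul_rowsub_mx /spectral_form !mulmxA (unitarymxP U_unitary) mul1mx.
by apply/matrixP => i j; rewrite !mul_diag_mx !mxE.
Qed.

(** The quadratic form at a unit eigenvector; it carries nonnegativity over to the eigenvalues. *)
Lemma spectral_form_row U d j : U \is unitarymx ->
  (row j U *m spectral_form U d *m (row j U)^t* ) 0 0 = d 0 j.
Proof.
move=> U_unitary; have UU1 := unitarymxP U_unitary.
rewrite -row_mul /spectral_form !mulmxA UU1 mul1mx.
have -> : row j (diag_mx d *m U) = d 0 j *: row j U.
  by apply/rowP => l; rewrite mxE mul_diag_mx !mxE.
rewrite -scalemxAl mxE -[RHS]mulr1; congr (_ * _).
move/matrixP/(_ j j): UU1; rewrite !mxE eqxx => UU1jj; rewrite -[RHS]UU1jj.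
by apply: eq_bigr => l _; rewrite !mxE.
Qed.

Lemma psd_spectral_form S :
    S = S^t* -> (forall x : 'cV[C]_n, 0 <= (x^t* *m S *m x) 0 0) ->
  S = spectral_form (spectralmx S) (spectral_diag S) /\
  forall j, 0 <= spectral_diag S 0 j.
Proof.
move=> S_herm S_ge0; have W_unitary := spectral_unitarymx S.
have SE : S = spectral_form (spectralmx S) (spectral_diag S).
  have S_hermsym : S \is hermsymmx.
    by apply/is_hermitianmxP; rewrite expr0 scale1r.
  rewrite {1}(orthomx_spectralP (hermitian_normalmx S_hermsym)).
  by rewrite invmx_unitary.
split=> // j; rewrite -(spectral_form_row _ j W_unitary) -SE.
by rewrite -{1}(trmxCK (row j (spectralmx S))).
Qed.

(** With [T := V *m E], the mixed Gram matrix of [T *m X] and [T *m Y] is [L] times the Gram matrix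
    of [T]. Cauchy-Schwarz and the two compression bounds compare determinants, and the squared Gram
    determinant of [T] cancels. *)
Lemma det_eigenframe_le k q (V : 'M[C]_(k, n)) (L : 'M[C]_k) (P E F : 'M[C]_n)
    (X Y : 'M[C]_(n, q)) (a b : C) :
    V *m V^t* = 1%:M -> V *m P = L *m V -> P = E *m F ->
    E *m (X *m Y^t* ) = P *m E ->
    (forall T : 'M[C]_(k, n),
       \det (T *m (X *m X^t* ) *m T^t* ) <= a * \det (T *m T^t* )) ->
    (forall T : 'M[C]_(k, n),
       \det (T *m (Y *m Y^t* ) *m T^t* ) <= b * \det (T *m T^t* )) ->
  `|\det L| ^+ 2 <= a * b.
Proof.
move=> VV1 VP PE EXY X_le Y_le; pose T := V *m E.
have gramM (Z : 'M[C]_(n, q)) (W : 'M[C]_(k, n)) :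
    (W *m Z) *m (W *m Z)^t* = W *m (Z *m Z^t* ) *m W^t*.
  by rewrite trmxC_mul !mulmxA.
(* Testing a bound at the orthonormal [V] makes its constant nonnegative, which settles the case of
   singular [L]. *)
have c_ge0 (Z : 'M[C]_(n, q)) c : (forall T : 'M[C]_(k, n),
    \det (T *m (Z *m Z^t* ) *m T^t* ) <= c * \det (T *m T^t* )) -> 0 <= c.
  move=> /(_ V); rewrite VV1 det1 mulr1; apply: le_trans.
  by rewrite -gramM det_gram_ge0.
have [-> | L_neq0] := eqVneq (\det L) 0.
  by rewrite normr0 expr0n mulr_ge0 ?(c_ge0 _ _ X_le) ?(c_ge0 _ _ Y_le).
(* T has full row rank, since T F = V P = L V with L invertible. *)
have T_gt0 : 0 < \det (T *m T^t* ).
  rewrite lt_def det_gram_ge0 andbT; apply: contra_neq L_neq0 => T0.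
  have := det_gram_CauchySchwarz T (V *m F^t* ).
  rewrite T0 mul0r trmxC_mul trmxCK mulmxA -[T *m F]mulmxA -PE VP -mulmxA VV1 mulmx1.
  by move=> L_le0; apply/eqP; rewrite -normr_eq0 -sqrf_eq0 eq_le L_le0 exprn_ge0.
have TXY : T *m X *m (T *m Y)^t* = L *m (T *m T^t* ).
  rewrite trmxC_mul !mulmxA; congr (_ *m _).
  by rewrite -!mulmxA EXY mulmxA VP -mulmxA.
have := det_gram_CauchySchwarz (T *m X) (T *m Y).
rewrite TXY !gramM det_mulmx normrM exprMn (gtr0_norm T_gt0) => CS.
rewrite -(ler_pM2r (exprn_gt0 2 T_gt0)); apply: le_trans CS _.
by rewrite expr2 mulrACA ler_pM // -gramM det_gram_ge0.
Qed.

End SpectralForm.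

(** * Products of a nonincreasing sequence over distinct indices *)

Lemma ltn_sorted_leq_nth (s : seq nat) j :
  sorted ltn s -> (j < size s)%N -> (j <= nth 0%N s j)%N.
Proof.
elim: j => // j IHj lt_s lt_js; apply: (leq_ltn_trans (IHj lt_s (ltnW lt_js))).
by rewrite (sorted_ltn_nth ltn_trans) ?inE // ltnW.
Qed.

(** Once the indices are sorted, number [j] of them is at least [j], so the products compare factor
    by factor. *)
Lemma prod_inj_le (R : numDomainType) (e : nat -> R) k (f : 'I_k -> nat) :
    (forall j, 0 <= e j) -> {homo e : i j / (i <= j)%N >-> j <= i} ->
    injective f ->
  \prod_i e (f i) <= \prod_(j < k) e j.
Proof.
move=> e_ge0 e_noninc f_inj; pose s := sort leq [seq f i | i : 'I_k].
have size_s : size s = k by rewrite size_sort size_map size_enum_ord.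
have lt_s : sorted ltn s.
  rewrite ltn_sorted_uniq_leq sort_uniq map_inj_uniq // enum_uniq.
  by rewrite sort_sorted //; exact: leq_total.
have -> : \prod_i e (f i) = \prod_(m <- s) e m.
  by rewrite (perm_big _ (permEl (perm_sort _ _))) big_image.
rewrite (big_nth 0%N) big_mkord size_s; apply: ler_prod => j _.
by rewrite e_ge0 e_noninc // ltn_sorted_leq_nth ?size_s.
Qed.

(** * Ordered eigenvalues of positive semidefinite matrices *)

Section Lambda.
Context {R : realType} {n : nat}.
Local Open Scope ring_scope.
Implicit Types (A S U : 'M[R[i]]_n) (e : 'rV[R]_n).

(** The characteristic polynomial splits over the entries of [e], so its list of roots is a
    permutation of them, and sorting forgets the permutation. *)
Lemma lambda_spectral_form U e j : U \is unitarymx ->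
  lambda (spectral_form U (\row_i (e 0 i)%:C)) j =
    nth 0 (sort >=%R [seq e 0 i | i : 'I_n]) j.
Proof.
move=> U_unitary; rewrite /lambda /eigenvalues; congr nth.
case: closed_field_poly_normal => s /= Ds.
apply/perm_sortP; [exact: ge_total|exact: ge_trans|exact: ge_anti|].
have -> : [seq e 0 i | i : 'I_n] =
    [seq complex.Re z | z <- [seq (e 0 i)%:C | i : 'I_n]].
  by rewrite -map_comp; apply: eq_map.
apply: perm_map; apply: prod_XsubC_eq.
move: Ds; rewrite (monicP (char_poly_monic _)) scale1r.
rewrite char_poly_spectral_form // big_image => <-.
by apply: eq_bigr => i _; rewrite mxE.
Qed.

(** Permuting the rows of [spectralmx S] sorts the eigenvalues. The resulting unitary does not
    depend on [p], so all powers of [S] are diagonalised together. *)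
Lemma psd_spectral_sorted S : psdmx S ->
  exists2 U, U \is unitarymx &
    S = spectral_form U (\row_j (lambda S j)%:C) /\
    forall p, mxpowR S p = spectral_form U (\row_j (lambda S j `^ p)%:C).
Proof.
move=> [S_herm S_ge0]; have W_unitary := spectral_unitarymx S.
have [SE sp_ge0] := psd_spectral_form S_herm S_ge0.
pose d j := complex.Re (spectral_diag S 0 j).
have {}SE : S = spectral_form (spectralmx S) (\row_j (d j)%:C).
  rewrite {1}SE; congr spectral_form; apply/rowP => j; rewrite mxE.
  by rewrite RRe_real // ger0_real.
have powE p : mxpowR S p = spectral_form (spectralmx S) (\row_j (d j `^ p)%:C).
  have -> : \row_j (d j `^ p)%:C =
      map_mx (fun z => (complex.Re z `^ p)%:C) (spectral_diag S).
    by apply/rowP => j; rewrite !mxE.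
  exact: erefl.
have /tuple_permP [s Ds] :
    perm_eq (sort >=%R [seq d j | j : 'I_n]) [tuple d j | j < n].
  by rewrite perm_sort.
have lamE (j : 'I_n) : lambda S j = d (s j).
  pose e := \row_j d j; have := lambda_spectral_form e j W_unitary.
  have -> : \row_j (e 0 j)%:C = \row_j (d j)%:C :> 'rV[R[i]]_n.
    by apply/rowP => i; rewrite !mxE.
  rewrite -SE => ->; have -> : [seq e 0 j | j : 'I_n] = [seq d j | j : 'I_n].
    by apply: eq_map => i; rewrite mxE.
  by rewrite Ds -tnth_nth !tnth_mktuple.
exists (row_perm s (spectralmx S)); first exact: unitarymx_row_perm.
have permE (f : R -> R) : spectral_form (spectralmx S) (\row_j (f (d j))%:C) =
    spectral_form (row_perm s (spectralmx S)) (\row_j (f (lambda S j))%:C).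
  rewrite -(spectral_form_perm _ _ s); congr spectral_form.
  by apply/rowP => j; rewrite !mxE lamE.
split; last by move=> p; rewrite powE (permE (fun x => x `^ p)).
by rewrite {1}SE (permE id).
Qed.

Lemma psd_lambda_ge0 S : psdmx S -> forall j, 0 <= lambda S j.
Proof.
move=> S_psd j; have [U U_unitary [SE _]] := psd_spectral_sorted S_psd.
(* From index [n] on, [nth] returns its default 0; the sign is wanted for the whole sequence, as
   [prod_inj_le] asks. *)
have [lt_jn|le_nj] := ltnP j n; last first.
  have := lambda_spectral_form (\row_i lambda S i) j U_unitary.
  have -> : \row_i ((\row_i lambda S i) 0 i)%:C = \row_i (lambda S i)%:C :> 'rV[R[i]]_n.
    by apply/rowP => i; rewrite !mxE.
  by rewrite -SE => ->; rewrite nth_default // size_sort size_map size_enum_ord.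
have := spectral_form_row (\row_i (lambda S i)%:C) (Ordinal lt_jn) U_unitary.
rewrite -SE [RHS]mxE => lamE; rewrite -ler0c -lamE.
by rewrite -{1}(trmxCK (row (Ordinal lt_jn) U)); case: S_psd.
Qed.

Lemma psd_lambda_noninc S : psdmx S ->
  {homo lambda S : i j / (i <= j)%N >-> j <= i}.
Proof.
move=> S_psd i j le_ij; rewrite {1}/lambda; set s := sort _ _.
have [lt_js|le_sj] := ltnP j (size s); last first.
  by rewrite nth_default // psd_lambda_ge0.
have s_sorted : sorted >=%R s by rewrite sort_sorted //; exact: ge_total.
exact: (sorted_leq_nth ge_trans ge_refl 0 s_sorted i j
  (leq_ltn_trans le_ij lt_js) lt_js le_ij).
Qed.

End Lambda.

(** * Products of the largest eigenvalues, and real powers *)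

Section PosPart.
Context {R : realType} {n : nat}.
Local Open Scope ring_scope.
Implicit Types (A S : 'M[R[i]]_n) (p s t : R).

Definition lambda_prod k S : R := \prod_(j < k) lambda S j.

Lemma lambda_prod_ge0 k S : psdmx S -> 0 <= lambda_prod k S.
Proof. by move=> S_psd; apply: prodr_ge0 => j _; exact: psd_lambda_ge0. Qed.

Lemma det_compression_le_lambda_prod k S (V : 'M[R[i]]_(k, n)) : psdmx S ->
  \det (V *m S *m V^t* ) <= (lambda_prod k S)%:C * \det (V *m V^t* ).
Proof.
move=> S_psd; have [U U_unitary [SE _]] := psd_spectral_sorted S_psd.
rewrite {1}SE; apply: det_compression_le => // f f_inj.
under eq_bigr => i _ do rewrite mxE.
rewrite -rmorph_prod lecR; apply: (@prod_inj_le R (lambda S) k (fun i => f i)).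
- exact: psd_lambda_ge0.
- exact: psd_lambda_noninc.
- by move=> i j /val_inj/f_inj.
Qed.

(** At this frame of eigenvectors the preceding bound is attained. *)
Lemma lambda_prod_frame k S : psdmx S -> (k <= n)%N ->
  exists (V : 'M[R[i]]_(k, n)) (L : 'M[R[i]]_k),
    [/\ V *m V^t* = 1%:M, V *m S = L *m V & \det L = (lambda_prod k S)%:C].
Proof.
move=> S_psd le_kn; have [U U_unitary [SE _]] := psd_spectral_sorted S_psd.
have [V VV1 VS] := spectral_form_frame le_kn (\row_j (lambda S j)%:C) U_unitary.
exists V; eexists; split; [by []|by rewrite {1}SE; exact: VS|].
by rewrite det_diag rmorph_prod; apply: eq_bigr => j _; rewrite !mxE.
Qed.

(** Each factor is at most [lambda S 0], which the hypothesis bounds by [c] at a unit eigenvector;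
    the 1 x 1 determinants are quadratic forms. *)
Lemma lambda_prod_le_exp k S (c : R) : psdmx S -> (k <= n)%N ->
    (forall v : 'rV[R[i]]_n,
       \det (v *m S *m v^t* ) <= c%:C * \det (v *m v^t* )) ->
  lambda_prod k S <= c ^+ k.
Proof.
move=> S_psd le_kn S_le.
have -> : c ^+ k = \prod_(j < k) c by rewrite prodr_const card_ord.
apply: ler_prod => j _; rewrite psd_lambda_ge0 //=.
have n_gt0 : (0 < n)%N by exact: leq_trans (leq_ltn_trans (leq0n j) (ltn_ord j)) le_kn.
apply: le_trans (psd_lambda_noninc S_psd (leq0n j)) _.
have [V [L [VV1 VS detL]]] := lambda_prod_frame S_psd n_gt0.
have := S_le V; rewrite VS -mulmxA VV1 mulmx1 detL det1 mulr1 lecR.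
by rewrite /lambda_prod big_ord1.
Qed.

Lemma psd_gram q (X : 'M[R[i]]_(n, q)) : psdmx (X *m X^t* ).
Proof.
split=> [|x]; first by rewrite trmxC_mul trmxCK.
have := det_gram_ge0 (x^t* *m X).
by rewrite det_mx11 trmxC_mul trmxCK !mulmxA.
Qed.

Lemma mxpowR_adj A p : psdmx A -> (mxpowR A p)^t* = mxpowR A p.
Proof.
move=> A_psd; have [U U_unitary [_ ->]] := psd_spectral_sorted A_psd.
apply: spectral_form_adj => j; rewrite mxE ger0_real // ler0c powR_ge0 //.
Qed.

Lemma mxpowRD A s t : psdmx A -> 0 <= s -> 0 <= t ->
  mxpowR A (s + t) = mxpowR A s *m mxpowR A t.
Proof.
move=> A_psd s0 t0; have [U U_unitary [_ powE]] := psd_spectral_sorted A_psd.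
rewrite !powE; apply: etrans (esym (spectral_form_mul _ _ U_unitary)).
congr spectral_form.
apply/rowP => j; rewrite !mxE -rmorphM; congr (_%:C).
(* [powRD] asks for a nonzero base when the exponents add up to 0. Here both exponents are then 0,
   and every power is 1, also at eigenvalue 0. *)
have [st0|st_neq0] := eqVneq (s + t) 0; last by rewrite powRD // (negPf st_neq0).
move/eqP: st0; rewrite paddr_eq0 // => /andP[/eqP-> /eqP->].
by rewrite addr0 powRr0 mulr1.
Qed.

(** The convention that 0 to the power 0 is 1 covers singular [A]. *)
Lemma mxpowR0 A : psdmx A -> mxpowR A 0 = 1%:M.
Proof.
move=> A_psd; have [U U_unitary [_ ->]] := psd_spectral_sorted A_psd.
rewrite -(spectral_form1 U_unitary); congr spectral_form.
by apply/rowP => j; rewrite !mxE powRr0.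
Qed.

Lemma mxpowR1 A : psdmx A -> mxpowR A 1 = A.
Proof.
move=> A_psd; have [U U_unitary [AE ->]] := psd_spectral_sorted A_psd.
rewrite [RHS]AE; congr spectral_form.
by apply/rowP => j; rewrite !mxE powRr1 // psd_lambda_ge0.
Qed.

Lemma mxpowR_compression_le A p : psdmx A ->
  exists2 c : R, 0 <= c & forall s, 0 <= s <= p -> forall v : 'rV[R[i]]_n,
    \det (v *m mxpowR A s *m v^t* ) <= c%:C * \det (v *m v^t* ).
Proof.
move=> A_psd; have [U U_unitary [_ powE]] := psd_spectral_sorted A_psd.
(* Adding 1 puts the base above 1, so that its powers grow with the exponent and one constant serves
   all [s]. *)
exists ((1 + lambda A 0) `^ p); first exact: powR_ge0.
move=> s /andP[s0 sp] v; rewrite powE; apply: det_compression_le => // f _.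
rewrite big_ord1 mxE lecR.
have lam0 := psd_lambda_ge0 A_psd.
apply: (@le_trans _ _ ((1 + lambda A 0) `^ s)).
  apply: ge0_ler_powR; rewrite ?nnegrE ?addr_ge0 //.
  by rewrite ler_wpDl // psd_lambda_noninc.
by rewrite ler_powR // lerDl.
Qed.

(** For [0 <= p] the power map is nondecreasing and keeps the eigenvalues sorted. At indices from
    [n] on the equation would fail for [p = 0], where the default 0 has power 1. *)
Lemma lambda_mxpowR S p j : psdmx S -> 0 <= p -> (j < n)%N ->
  lambda (mxpowR S p) j = lambda S j `^ p.
Proof.
move=> S_psd p0 lt_jn; have [U U_unitary [_ powE]] := psd_spectral_sorted S_psd.
have := lambda_spectral_form (\row_i (lambda S i `^ p)) j U_unitary.
have -> : \row_i ((\row_i (lambda S i `^ p)) 0 i)%:C =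
    \row_i (lambda S i `^ p)%:C :> 'rV[R[i]]_n.
  by apply/rowP => i; rewrite !mxE.
rewrite -powE => ->.
have -> : [seq (\row_i (lambda S i `^ p)) 0 i | i : 'I_n] =
    [seq lambda S m `^ p | m <- iota 0 n].
  rewrite -val_enum_ord -map_comp; apply: eq_map => i.
  by rewrite mxE.
rewrite sorted_sort; last 1 first.
- rewrite sorted_map; apply: sub_sorted (iota_sorted 0 n) => a b le_ab /=.
  by apply: ge0_ler_powR; rewrite ?nnegrE ?psd_lambda_ge0 // psd_lambda_noninc.
- by rewrite (nth_map 0%N) ?size_iota // nth_iota.
- exact: ge_trans.
Qed.

End PosPart.

(** * Bounded midpoint log-convex functions on an interval *)

Section MidpointConvexity.
Context {R : realType}.
Implicit Types (h : R -> R) (p K c : R).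

(** Each [s] is the midpoint of 0 and [2s], or of [2s - p] and [p]. The other end [t] stays in the
    interval and satisfies [h s ^+ 2 <= h t], so a value above 1 would be squared again and again,
    past the bound [K]. *)
Lemma midpoint_convex_le1 h p K :
    (forall s, 0 <= s <= p -> 0 <= h s <= K) ->
    (forall s t, 0 <= s -> s <= t -> t <= p -> h ((s + t) / 2) ^+ 2 <= h s * h t) ->
    h 0 <= 1 -> h p <= 1 ->
  forall s, 0 <= s <= p -> h s <= 1.
Proof.
move=> h_bound h_mid h0 hp.
have h_iter j : forall s, 0 <= s <= p -> h s ^+ (2 ^ j) <= K.
  elim: j => [|j IHj] s /andP[s0 sp].
    by have /andP[] := h_bound s ltac:(by rewrite s0 sp).
  have [t t_bound hst] : exists2 t, 0 <= t <= p & h s ^+ 2 <= h t.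
    have [le_2s|gt_2s] := leP (s + s) p.
      exists (s + s); first by lra.
      have := h_mid 0 (s + s) (lexx 0) ltac:(lra) le_2s.
      have -> : (0 + (s + s)) / 2 = s by lra.
      move=> /le_trans; apply; apply: ler_piMl => //.
      by have /andP[] := h_bound (s + s) ltac:(lra).
    exists (s + s - p); first by lra.
    have := h_mid (s + s - p) p ltac:(lra) ltac:(lra) (lexx p).
    have -> : (s + s - p + p) / 2 = s by lra.
    move=> /le_trans; apply; apply: ler_piMr => //.
    by have /andP[] := h_bound (s + s - p) ltac:(lra).
  rewrite expnS exprM; apply: le_trans (IHj t t_bound).
  have [/andP[ht0 _] /andP[hs0 _]] := (h_bound t t_bound, h_bound s ltac:(lra)).
  by rewrite lerXn2r // nnegrE exprn_ge0.
move=> s s_bound; rewrite leNgt; apply/negP => hs_gt1.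
pose e := h s - 1; have e_gt0 : 0 < e by rewrite subr_gt0.
have bernoulli m : 1 + m%:R * e <= h s ^+ m.
  elim: m => [|m IHm]; first by rewrite mul0r addr0 expr0.
  rewrite exprS; apply: le_trans (ler_wpM2l (le_trans ler01 (ltW hs_gt1)) IHm).
  have -> : h s = 1 + e by rewrite /e; lra.
  have : 0 <= m%:R * e * e by rewrite !mulr_ge0 // ltW.
  by rewrite -natr1; lra.
have K0 : 0 <= K by have /andP[hs0] := h_bound s s_bound; exact: le_trans.
(* [m * e] exceeds [K] and [m] is below [2 ^ m], so Bernoulli at exponent [2 ^ m] contradicts
   [h_iter]. *)
pose m := Num.bound (K / e).
have := le_trans (bernoulli (2 ^ m)%N) (h_iter m s s_bound).
apply/negP; rewrite -ltNge.
have : K / e < m%:R by rewrite archi_boundP // divr_ge0 // ltW.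
rewrite ltr_pdivrMr // => lt_K.
have : m%:R * e <= (2 ^ m)%:R * e by rewrite ler_pM2r // ler_nat ltnW // ltn_expl.
by lra.
Qed.

Lemma midpoint_log_convex_le h p K : 1 <= p ->
    (forall s, 0 <= s <= p -> 0 <= h s <= K) ->
    (forall s t, 0 <= s -> s <= t -> t <= p -> h ((s + t) / 2) ^+ 2 <= h s * h t) ->
    h 0 <= 1 ->
  h 1 `^ p <= h p.
Proof.
move=> p1 h_bound h_mid h0; have p0 : 0 < p by lra.
have h_ge0 s : 0 <= s -> s <= p -> 0 <= h s.
  by move=> s0 sp; have /andP[] := h_bound s ltac:(by rewrite s0 sp).
have scaled c : 0 < c -> h p * c <= 1 -> h 1 `^ p * c <= 1.
  move=> c0 hpc; pose g s := h s * c `^ (s / p).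
  suff : g 1 <= 1.
    rewrite /g => g1; have -> : h 1 `^ p * c = (h 1 * c `^ (1 / p)) `^ p.
      rewrite powRM ?powR_ge0 ?h_ge0 // -powRrM divfK ?gt_eqF // powRr1 //.
      exact: ltW.
    apply: (@le_trans _ _ (1 `^ p)); last by rewrite powR1.
    apply: ge0_ler_powR; rewrite ?nnegrE ?(ltW p0) //.
    by rewrite mulr_ge0 ?powR_ge0 ?h_ge0.
  (* As [s / p] lies between 0 and 1, [1 + c] bounds the extra factor. *)
  apply: (@midpoint_convex_le1 g p (K * (1 + c))); last by rewrite ler01.
  - move=> s /[dup] s_bound /andP[s0 sp]; have /andP[hs0 hsK] := h_bound s s_bound.
    rewrite /g mulr_ge0 ?powR_ge0 //= ler_pM ?powR_ge0 //.
    apply: (@le_trans _ _ ((1 + c) `^ (s / p))).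
      by apply: ge0_ler_powR; rewrite ?nnegrE ?divr_ge0 ?addr_ge0 ?lerDr // ltW.
    rewrite -[leRHS]powRr1 ?addr_ge0 ?ler_powR ?lerDl ?ler_pdivrMr ?mul1r // ltW //.
  - move=> s t s0 st tp; rewrite /g exprMn [leRHS]mulrACA; apply: ler_pM.
    + by rewrite exprn_ge0 // h_ge0 //; lra.
    + by rewrite exprn_ge0 // powR_ge0.
    + exact: h_mid.
    rewrite expr2 -!powRD ?(gt_eqF c0) ?implybT //.
    have -> : (s + t) / 2 / p + (s + t) / 2 / p = s / p + t / p.
      by field; rewrite gt_eqF.
    by [].
  - by rewrite /g mul0r powRr0 mulr1.
  - by rewrite /g divff ?gt_eqF // powRr1 // ltW.
rewrite leNgt; apply/negP => lt_hp; pose y := h 1 `^ p.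
have hp0 := h_ge0 p (ltW p0) (lexx p).
have sum_gt0 : 0 < h p + y by rewrite ltr_wpDl // (le_lt_trans hp0).
(* The inverse of the mean of [h p] and [y] makes sense even if [h p = 0]. If [h p < y], it scales
   [h p] below 1 and [y] above 1. *)
have := scaled (2 / (h p + y)) ltac:(by rewrite divr_gt0).
rewrite !mulrA !ler_pdivrMr // mul1r -/y => /(_ ltac:(rewrite /y; lra)).
by rewrite /y; lra.
Qed.

End MidpointConvexity.

(** * Algebra of the products [A Z^* B Z A] *)

Section ContractionProduct.
Context {C : numClosedFieldType} {n : nat}.
Local Open Scope ring_scope.
Implicit Types (A B H Z E : 'M[C]_n).

Lemma gram_sandwich A H Z : A^t* = A -> H^t* = H ->
  (A *m Z^t* *m H) *m (A *m Z^t* *m H)^t* = A *m Z^t* *m (H *m H) *m Z *m A.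
Proof. by move=> AE HE; rewrite !trmxC_mul trmxCK AE HE !mulmxA. Qed.

Lemma sandwich_factorl A0 A H E Z : A = E *m A0 ->
  A *m Z^t* *m H *m Z *m A = E *m (A0 *m Z^t* *m H *m Z *m A).
Proof. by move=> {1}->; rewrite !mulmxA. Qed.

(** Used with [A0], [A], [A1] the powers of one matrix at s, m, t and [E] its power at m - s = t -
    m: [E] completes [A0] to [A] on the left and splits off [A1] on the right. *)
Lemma sandwich_intertwine A0 A A1 H0 H1 E Z : A1^t* = A1 -> H1^t* = H1 ->
    A = E *m A0 -> A1 = A *m E ->
  E *m ((A0 *m Z^t* *m H0) *m (A1 *m Z^t* *m H1)^t* ) =
    (A *m Z^t* *m (H0 *m H1) *m Z *m A) *m E.
Proof.
move=> A1E H1E AE A1M.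
by rewrite !trmxC_mul trmxCK A1E H1E A1M !mulmxA -AE.
Qed.

Lemma contraction_compression_le Z (v : 'rV[C]_n) :
    (forall x : 'cV[C]_n, 0 <= (x^t* *m (1%:M - Z^t* *m Z) *m x) 0 0) ->
  \det (v *m Z^t* *m Z *m v^t* ) <= \det (v *m v^t* ).
Proof.
move=> /(_ (v^t* )); rewrite trmxCK mulmxBr mulmxBl mulmx1 mxE [X in _ + X]mxE subr_ge0.
by rewrite !det_mx11 !mulmxA.
Qed.

(** Peels from the inside out: first [B], then the contraction at [v *m A], and last [A *m A] at
    [v]. *)
Lemma sandwich_compression_le A B Z (v : 'rV[C]_n) (a b : C) :
    0 <= b -> A^t* = A ->
    (forall x : 'cV[C]_n, 0 <= (x^t* *m (1%:M - Z^t* *m Z) *m x) 0 0) ->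
    (forall w : 'rV[C]_n, \det (w *m B *m w^t* ) <= b * \det (w *m w^t* )) ->
    (forall w : 'rV[C]_n, \det (w *m (A *m A) *m w^t* ) <= a * \det (w *m w^t* )) ->
  \det (v *m (A *m Z^t* *m B *m Z *m A) *m v^t* ) <= b * a * \det (v *m v^t* ).
Proof.
move=> b0 AE Z_contr B_le A_le; rewrite -mulrA.
have := B_le (v *m A *m Z^t* ).
rewrite !trmxC_mul trmxCK AE !mulmxA => /le_trans; apply.
rewrite ler_wpM2l //.
have := contraction_compression_le (v *m A) Z_contr.
rewrite trmxC_mul AE !mulmxA => /le_trans; apply.
by have := A_le v; rewrite !mulmxA.
Qed.

End ContractionProduct.

Lemma sqr_le_real_complex (R : realType) (x y z : R) :
  0 <= x -> `|x%:C| ^+ 2 <= y%:C * z%:C -> x ^+ 2 <= y * z.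
Proof. by move=> x0; rewrite ger0_norm ?ler0c // -rmorphXn -rmorphM lecR. Qed.

Lemma prod_powR (R : realType) (f : nat -> R) k p : (forall j, 0 <= f j) ->
  \prod_(j < k) f j `^ p = (\prod_(j < k) f j) `^ p.
Proof.
move=> f_ge0; elim: k => [|k IHk]; first by rewrite !big_ord0 powR1.
by rewrite !big_ord_recr /= IHk powRM // prodr_ge0.
Qed.

(** * Eigenvalue products of Gram matrices and of powers *)

Section LambdaProd.
Context {R : realType} {n : nat}.
Local Open Scope ring_scope.
Implicit Types (S X Y E F : 'M[R[i]]_n).

Lemma lambda_prod_sqr_le k S S0 S1 X Y E F : psdmx S -> (k <= n)%N ->
    S0 = X *m X^t* -> S1 = Y *m Y^t* -> S = E *m F ->
    E *m (X *m Y^t* ) = S *m E ->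
  lambda_prod k S ^+ 2 <= lambda_prod k S0 * lambda_prod k S1.
Proof.
move=> S_psd le_kn S0E S1E SE EXY.
have [V [L [VV1 VL detL]]] := lambda_prod_frame S_psd le_kn.
have S0_psd : psdmx S0 by rewrite S0E; exact: psd_gram.
have S1_psd : psdmx S1 by rewrite S1E; exact: psd_gram.
have le0 T := det_compression_le_lambda_prod (k := k) T S0_psd.
have le1 T := det_compression_le_lambda_prod (k := k) T S1_psd.
rewrite {1}S0E in le0; rewrite {1}S1E in le1.
have := det_eigenframe_le VV1 VL SE EXY le0 le1.
rewrite detL; have := lambda_prod_ge0 k S_psd.
move: (lambda_prod k S) (lambda_prod k S0) (lambda_prod k S1) => x y z.
exact: sqr_le_real_complex.
Qed.

Lemma lambda_prod_mxpowR k S p : psdmx S -> 0 <= p -> (k <= n)%N ->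
  lambda_prod k (mxpowR S p) = lambda_prod k S `^ p.
Proof.
move=> S_psd p0 le_kn.
transitivity (\prod_(j < k) lambda S j `^ p).
  apply: eq_bigr => j _; apply: lambda_mxpowR => //.
  exact: leq_trans (ltn_ord j) le_kn.
exact: (prod_powR k p (psd_lambda_ge0 S_psd)).
Qed.

End LambdaProd.

(** * The family joining the two sides of the theorem *)

Section Sandwich.
Context {R : realType} {n : nat}.
Local Open Scope ring_scope.
Context (A B Z : 'M[R[i]]_n).
Context (A_psd : psdmx A) (B_psd : psdmx B) (Z_contr : contraction Z).

(** This is P_s, and [factor s] below is N_s. The exponents 1 and [p] give the two products of the
    theorem. *)
Definition sandwich (s : R) : 'M[R[i]]_n :=
  mxpowR A s *m Z^t* *m mxpowR B s *m Z *m mxpowR A s.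

Let factor (s : R) : 'M[R[i]]_n := mxpowR A s *m Z^t* *m mxpowR B (s / 2).

Lemma sandwich_gram s : 0 <= s -> sandwich s = factor s *m (factor s)^t*.
Proof.
move=> s0; have BE : mxpowR B s = mxpowR B (s / 2) *m mxpowR B (s / 2).
  by rewrite {1}(splitr s) mxpowRD ?divr_ge0.
rewrite /sandwich BE.
exact: esym (gram_sandwich Z (mxpowR_adj s A_psd) (mxpowR_adj (s / 2) B_psd)).
Qed.

Lemma sandwich_psd s : 0 <= s -> psdmx (sandwich s).
Proof. by move=> /sandwich_gram ->; exact: psd_gram. Qed.

Lemma sandwich_bound k p : (k <= n)%N -> exists K : R,
  forall s, 0 <= s <= p -> lambda_prod k (sandwich s) <= K.
Proof.
move=> le_kn; have [b b0 B_le] := mxpowR_compression_le p B_psd.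
(* The power of [A] occurs twice, so its exponent reaches [p + p]. *)
have [a a0 A_le] := mxpowR_compression_le (p + p) A_psd.
exists ((b * a) ^+ k) => s s_bound; have /andP[s0 sp] := s_bound.
apply: (lambda_prod_le_exp (sandwich_psd s0) le_kn) => v.
rewrite rmorphM; apply: sandwich_compression_le.
- by rewrite ler0c.
- exact: mxpowR_adj.
- by case: Z_contr.
- exact: B_le.
- by move=> w; rewrite -(mxpowRD A_psd s0 s0); apply: A_le; rewrite addr_ge0 //= lerD.
Qed.

Lemma sandwich0_le1 k : (k <= n)%N -> lambda_prod k (sandwich 0) <= 1.
Proof.
move=> le_kn; rewrite -[leRHS](expr1n _ k).
apply: (lambda_prod_le_exp (sandwich_psd (lexx 0)) le_kn) => v.
have [_ Z_le] := Z_contr.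
have := contraction_compression_le v Z_le.
rewrite rmorph1 mul1r /sandwich (mxpowR0 A_psd) (mxpowR0 B_psd).
by rewrite mul1mx !mulmx1 mulmxA.
Qed.

Lemma sandwich_midpoint k s t : (k <= n)%N -> 0 <= s -> s <= t ->
  lambda_prod k (sandwich ((s + t) / 2)) ^+ 2 <=
    lambda_prod k (sandwich s) * lambda_prod k (sandwich t).
Proof.
(* [d] is both [m - s] and [t - m], so one factor [mxpowR A d] leads from s to m and from m to t. *)
move=> le_kn s0 st; set m := (s + t) / 2; pose d := (t - s) / 2.
have [t0 m0 d0] : [/\ 0 <= t, 0 <= m & 0 <= d] by split; rewrite /m /d; lra.
have mE : m = d + s by rewrite /m /d; lra.
have tE : t = m + d by rewrite /m /d; lra.
have mE2 : m = s / 2 + t / 2 by rewrite /m mulrDl.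
clearbody m d.
have Bm : mxpowR B m = mxpowR B (s / 2) *m mxpowR B (t / 2).
  by rewrite mE2; apply: mxpowRD => //; exact: divr_ge0.
have Am : mxpowR A m = mxpowR A d *m mxpowR A s by rewrite mE; exact: mxpowRD.
have At : mxpowR A t = mxpowR A m *m mxpowR A d by rewrite tE; exact: mxpowRD.
have PE : sandwich m = mxpowR A d *m
    (mxpowR A s *m Z^t* *m mxpowR B m *m Z *m mxpowR A m).
  exact: (sandwich_factorl _ _ Am).
have EXY : mxpowR A d *m (factor s *m (factor t)^t* ) =
    sandwich m *m mxpowR A d.
  rewrite /sandwich Bm.
  exact: (sandwich_intertwine _ Z (mxpowR_adj t A_psd) (mxpowR_adj (t / 2) B_psd)
    Am At).
exact: (lambda_prod_sqr_le (sandwich_psd m0) le_kn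
  (sandwich_gram s0) (sandwich_gram t0) PE EXY).
Qed.

End Sandwich.

Theorem corollary2p3 (R : realType) (n : nat) (A B : 'M[R[i]]_n) (p : R)
    (hA : psdmx A) (hB : psdmx B) (hp : 1 <= p) :
  forall Z : 'M[R[i]]_n, contraction Z ->
    weak_log_maj
      (mxpowR (A *m Z^t* *m B *m Z *m A) p)
      (mxpowR A p *m Z^t* *m mxpowR B p *m Z *m mxpowR A p).
Proof.
move=> Z Z_contr k /andP[_ le_kn].
have sandwich1 : A *m Z^t* *m B *m Z *m A = sandwich A B Z 1.
  by rewrite /sandwich (mxpowR1 hA) (mxpowR1 hB).
have [K K_bound] := sandwich_bound hA hB Z_contr p le_kn.
have := @midpoint_log_convex_le _ (fun s => lambda_prod k (sandwich A B Z s)) p K hp.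
(* The power of the eigenvalue product at 1 is read as the eigenvalue product of the matrix
   power. *)
rewrite -(lambda_prod_mxpowR (sandwich_psd Z hA hB ler01) (le_trans ler01 hp) le_kn).
rewrite -sandwich1; apply=> [s /[dup] s_bound /andP[s0 _]|s t s0 st _|].
- by rewrite K_bound // andbT; exact: lambda_prod_ge0 (sandwich_psd Z hA hB s0).
- exact: sandwich_midpoint.
- exact: sandwich0_le1.
Qed.
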